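(* The following two assertions are equivalent. (A) There exists a universal constant $C>0$ such that for every $n\in\mathbb{N}$ and every convex body $K\subset\mathbb{R}^n$, with $c_K$ denoting the center of the John ellipsoid $B_K$ of $K$, $$\mathrm{vol}\big(K\cap (c_K+C\sqrt{n}\,(B_K-c_K))\big)\ge \tfrac12\mathrm{vol}(K).$$ (B) There exists a universal constant $C>0$ such that for every $n\in\mathbb{N}$ and every convex body $K\subset\mathbb{R}^n$, with $c_K$ denoting the center of the John ellipsoid $B_K$ of $K$, the center of mass $x_K$ of $K$ satisfies $$x_K\in c_K+C\sqrt{n}\,(B_K-c_K).$$
   Context: A convex body in $\mathbb{R}^n$ is a convex compact subset with non-empty interior. The John ellipsoid $B_K$ of a convex body $K\subset\mathbb{R}^n$ is the unique ellipsoid of maximal volume contained in $K$ (existence and uniqueness are classical). The center of mass of $K$ is $x_K=\frac{1}{\mathrm{vol}(K)}\int_K x\,dx$. ''Universal constant'' means a number independent of $n$ and of $K$. The set $c_K+C\sqrt n\,(B_K-c_K)$ is the John ellipsoid scaled by the factor $C\sqrt n$ about its center. *)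

(* Defs.v *)
From HB Require Import structures.
From mathcomp Require Import all_boot all_order all_algebra.
From mathcomp Require Import all_classical all_reals all_analysis.

Set Implicit Arguments.
Unset Strict Implicit.
Unset Printing Implicit Defensive.

Import Order.TTheory GRing.Theory Num.Theory.
Import numFieldNormedType.Exports.

Local Open Scope classical_set_scope.
Local Open Scope ring_scope.

(* The library has no Lebesgue measure in dimension n.  Row vectors get the
   product sigma-algebra (as tuples do in the library), and vol is the n-fold
   product of the one-dimensional Lebesgue measure, transported along the
   bijection R * R^n -> R^(1 + n). *)

Definition measure_rV_display : measure_display. Proof. exact. Qed.

Section measurable_rV.
Context {R : realType}.
Variable n : nat.

Let coord (i : 'I_n) (x : 'rV[R]_n) : R := x 0 i.

Let rV_set0 : g_sigma_preimage coord set0.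
Proof. exact: sigma_algebra0. Qed.

Let rV_setC A : g_sigma_preimage coord A -> g_sigma_preimage coord (~` A).
Proof. exact: sigma_algebraC. Qed.

Let rV_bigcup (F : (set 'rV[R]_n)^nat) :
  (forall i, g_sigma_preimage coord (F i)) ->
  g_sigma_preimage coord (\bigcup_i (F i)).
Proof. exact: sigma_algebra_bigcup. Qed.

HB.instance Definition _ := @isMeasurable.Build measure_rV_display
  'rV[R]_n (g_sigma_preimage coord) rV_set0 rV_setC rV_bigcup.

End measurable_rV.

Lemma measurable_coord (R : realType) n (i : 'I_n) :
  measurable_fun [set: 'rV[R]_n] (fun x => x 0 i : R).
Proof.
move=> _ Y mY; rewrite setTI; apply: sub_sigma_algebra => /=.
rewrite -bigcup_seq/=; exists i => /=; first by rewrite mem_index_enum.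
by exists Y => //; rewrite setTI.
Qed.

Lemma measurable_fun_rVP (R : realType) d (T : measurableType d) n
    (f : T -> 'rV[R]_n) :
  measurable_fun setT f <->
  forall i, measurable_fun setT (fun t => f t 0 i : R).
Proof.
apply: (@iff_trans _ (g_sigma_preimage
    (fun i => (fun x : 'rV[R]_n => x 0 i : R) \o f) `<=` measurable)).
  rewrite g_sigma_preimage_comp; split=> [mf A [/= C preC <-]|prefS].
    exact: mf.
  by move=> _ A mA; apply: prefS; exists A.
split=> [fS i|mf].
- move=> _ A mA; apply: fS; apply: sub_sigma_algebra.
  rewrite -bigcup_seq/=; exists i => /=; first by rewrite mem_index_enum.
  by exists A.
- apply: smallest_sub; first exact: sigma_algebra_measurable.
  rewrite -bigcup_seq/=; apply: bigcup_sub => i _.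
  by move=> A [B mB <-]; exact: mf.
Qed.

Section lebesgue_rV.
Context {R : realType}.

Definition consrV n (p : R * 'rV[R]_n) : 'rV[R]_n.+1 :=
  row_mx (p.1%:M : 'rV_1) p.2.

Definition unconsrV n (x : 'rV[R]_n.+1) : R * 'rV[R]_n :=
  (x 0 0, rsubmx (x : 'rV_(1 + n))).

Lemma consrVK n : cancel (@consrV n) (@unconsrV n).
Proof.
case=> a v; rewrite /unconsrV /consrV row_mxKr /=; congr pair.
transitivity (row_mx (a%:M : 'rV_1) v 0 (lshift n (0 : 'I_1))).
  by congr (row_mx _ _ _ _); exact/val_inj.
by rewrite row_mxEl mxE eqxx mulr1n.
Qed.

Lemma measurable_consrV n : measurable_fun setT (@consrV n).
Proof.
apply/measurable_fun_rVP => i.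
have [j|j] := split_ordP (i : 'I_(1 + n)) => ->.
  rewrite (_ : (fun _ => _) = fst); first exact: measurable_fst.
  apply/funext => -[a v].
  transitivity (row_mx (a%:M : 'rV_1) v 0 (lshift n j)) => //.
  by rewrite row_mxEl ord1 mxE eqxx mulr1n.
rewrite (_ : (fun _ => _) = (fun v : 'rV[R]_n => v 0 j : R) \o snd).
  by apply: measurableT_comp; [exact: measurable_coord|exact: measurable_snd].
apply/funext => -[a v].
transitivity (row_mx (a%:M : 'rV_1) v 0 (rshift 1 j)) => //.
by rewrite row_mxEr.
Qed.

Lemma measurable_unconsrV n : measurable_fun setT (@unconsrV n).
Proof.
apply: measurable_fun_pair; first exact: measurable_coord.
apply/measurable_fun_rVP => i.
rewrite (_ : (fun _ => _) = (fun x : 'rV[R]_n.+1 => x 0 (rshift 1 i) : R)).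
  exact: measurable_coord.
by apply/funext => x; rewrite mxE.
Qed.

Definition lebesgue_step n (mu : {sigma_finite_measure set 'rV[R]_n -> \bar R}) :
    set 'rV[R]_n.+1 -> \bar R :=
  pushforward (lebesgue_measure \x mu)%E (@consrV n).

Section step.
Variables (n : nat) (mu : {sigma_finite_measure set 'rV[R]_n -> \bar R}).

Let measurable_preimage (A : set 'rV[R]_n.+1) :
  measurable A -> measurable (@consrV n @^-1` A).
Proof.
by move=> mA; rewrite -[X in measurable X]setTI; exact: measurable_consrV.
Qed.

Let lebesgue_step0 : lebesgue_step mu set0 = 0%E.
Proof. by rewrite /lebesgue_step /pushforward preimage_set0 measure0. Qed.

Let lebesgue_step_ge0 A : (0 <= lebesgue_step mu A)%E.
Proof. by rewrite /lebesgue_step /pushforward; exact: measure_ge0. Qed.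

Let lebesgue_step_sigma_additive : semi_sigma_additive (lebesgue_step mu).
Proof.
move=> F mF tF mUF; rewrite /lebesgue_step /pushforward preimage_bigcup.
apply: measure_semi_sigma_additive.
- by move=> i; exact: measurable_preimage.
- apply/trivIsetP => i j _ _ ij; rewrite -preimage_setI.
  by move/trivIsetP : tF => /(_ _ _ _ _ ij) ->//; rewrite preimage_set0.
- by rewrite -preimage_bigcup; exact: measurable_preimage.
Qed.

HB.instance Definition _ := isMeasure.Build _ _ _ (lebesgue_step mu)
  lebesgue_step0 lebesgue_step_ge0 lebesgue_step_sigma_additive.

(* Canonical inference for m1 \x m2 only finds the sigma-finite structure of a
   product of subprobabilities, so the product cover is rebuilt by hand. *)
Let lebesgue_step_sigma_finite : sigma_finite setT (lebesgue_step mu).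
Proof.
have /sigma_finiteP[F [TF ndF Foo]] := sigma_finiteT (@lebesgue_measure R).
have /sigma_finiteP[G [TG ndG Goo]] := sigma_finiteT mu.
exists (fun k => @unconsrV n @^-1` (F k `*` G k)).
  apply/esym; rewrite -subTset => x _.
  have [k _ Fk] : (\bigcup_k F k) (unconsrV x).1 by rewrite -TF.
  have [l _ Gl] : (\bigcup_k G k) (unconsrV x).2 by rewrite -TG.
  exists (maxn k l) => //; split.
    by move: Fk; exact/subsetPset/ndF/leq_maxl.
  by move: Gl; exact/subsetPset/ndG/leq_maxr.
move=> k; have [mFk Fkoo] := Foo k; have [mGk Gkoo] := Goo k.
have mFG : measurable (F k `*` G k) by exact: measurableX.
split.
  by rewrite -[X in measurable X]setTI; exact: measurable_unconsrV.
rewrite /lebesgue_step /pushforward -comp_preimage.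
rewrite (_ : _ \o _ = id); last by apply/funext => p; exact: consrVK.
by rewrite product_measure1E// lte_mul_pinfty// ge0_fin_numE.
Qed.

HB.instance Definition _ := Measure_isSigmaFinite.Build _ _ _
  (lebesgue_step mu) lebesgue_step_sigma_finite.

End step.

Fixpoint vol n : {sigma_finite_measure set 'rV[R]_n -> \bar R} :=
  if n is n'.+1 return {sigma_finite_measure set 'rV[R]_n -> \bar R}
  then lebesgue_step (vol n') else \d_(0 : 'rV[R]_0).

End lebesgue_rV.
Arguments vol {R n}.

Section convex_bodies.
Context {R : realType} {n : nat}.
Implicit Types (K B E : set 'rV[R]_n) (c x : 'rV[R]_n).

Definition convex_body K := [/\ convex_set K, compact K & K° !=set0].

Definition center_of_mass K : 'rV[R]_n :=
  \row_i ((fine (vol K))^-1 * \int[vol]_(x in K) (x 0 i)).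

(* The norm of the library on row vectors is the sup norm. *)
Definition euclidean_unit_ball : set 'rV[R]_n :=
  [set x | \sum_i x 0 i ^+ 2 <= 1].

Definition ellipsoid_centered_at c E := exists2 A : 'M[R]_n,
  A \in unitmx & E = [set c + x *m A | x in euclidean_unit_ball].

Definition ellipsoid E := exists c, ellipsoid_centered_at c E.

(* By John's theorem, a convex body has exactly one such B. *)
Definition john_ellipsoid K B :=
  [/\ ellipsoid B, B `<=` K &
      forall E, ellipsoid E -> E `<=` K -> (vol E <= vol B)%E].

Definition scale_about c (t : R) B : set 'rV[R]_n :=
  [set c + t *: (x - c) | x in B].

End convex_bodies.

(* Main.v *)
(** Both assertions fail for every constant C, hence they are equivalent.

Let u_0, ..., u_N be the unit outer normals of the regular simplex S
circumscribed about the unit ball B of R^N, and put y_i(x) = 1 - <x, u_i>, so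
that the y_i are nonnegative on S and add up to N + 1.  Every convex body between
B and S has John ellipsoid B.  One such body is the part K of S where
y_i + y_j >= (1 - y_0 / s) / 2 for all distinct i, j > 0, with s = (N + 1) / 20.
It contains {y_0 >= s}, which is a homothetic copy of S of ratio 19/20.  On the
other hand, at a point of K with y_0 <= s / 2 all but one of the y_i, i > 0, are
at least 1/8, which leaves N + 1 homothetic copies of S of ratio at most 9/10.
For large N these have a negligible share of the volume of K, so that most of K,
and its center of mass, lie at height y_0 of order N, while y_0 is at most of
order sqrt N on C sqrt N B. *)

From HB Require Import structures.
Require Import Defs.
From mathcomp Require Import all_boot all_order all_algebra.
From mathcomp Require Import all_classical all_reals all_analysis.
From mathcomp Require Import measurable_realfun.
From mathcomp Require Import ring lra.

Set Implicit Arguments.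
Unset Strict Implicit.
Unset Printing Implicit Defensive.

Import Order.TTheory GRing.Theory Num.Theory.
Import numFieldNormedType.Exports.

Local Open Scope classical_set_scope.
Local Open Scope ring_scope.

(** * Volume under triangular affine maps *)

Section affine_volume.
Context {R : realType}.

Let aff (t b : R) (y : measurableTypeR R) : measurableTypeR R := y * t + b.

Let measurable_aff t b : measurable_fun setT (aff t b).
Proof. by apply: measurable_funD => //; apply: measurable_funM. Qed.

HB.instance Definition _ t b :=
  isMeasurableFun.Build _ _ _ _ (aff t b) (measurable_aff t b).

(** Both sides are measures in [X] that agree on half-open intervals, so uniqueness of the Lebesgue
    measure applies; [0 < t] preserves the order of the endpoints. *)
Let lebesgue_aff t b (X : set (measurableTypeR R)) : 0 < t -> measurable X ->
  lebesgue_measure X =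
  (t%:E * pushforward (@lebesgue_measure R) (aff t b) X)%E.
Proof.
move=> t0 mX; pose k : {nonneg R} := NngNum (ltW t0).
rewrite [RHS](_ : _ = mscale k (pushforward lebesgue_measure (aff t b)) X) //.
apply: lebesgue_measure_unique => // _ [[c d]] _ <-.
change (lebesgue_measure `]c, d]%classic =
  t%:E * lebesgue_measure (aff t b @^-1` `]c, d]%classic))%E.
rewrite (_ : _ @^-1` _ = `]((c - b) / t), ((d - b) / t)]%classic).
  rewrite !lebesgue_measure_itv /= !lte_fin ltr_pM2r ?invr_gt0// ltrD2r.
  case: ifPn => _; last by rewrite mule0.
  by rewrite -!EFinB -EFinM; congr EFin; field; rewrite gt_eqF.
by apply/seteqP; split=> y /=; rewrite /aff !in_itv /= ltr_pdivrMr//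
  ler_pdivlMr// ltrBlDr lerBrDr.
Qed.

Let integral_aff t b (f : measurableTypeR R -> \bar R) : 0 < t ->
  measurable_fun setT f -> (forall x, 0 <= f x)%E ->
  (\int[lebesgue_measure]_x f x =
   t%:E * \int[lebesgue_measure]_x f (x * t + b)%R)%E.
Proof.
move=> t0 mf f0; pose k : {nonneg R} := NngNum (ltW t0).
have /= := @ge0_integral_pushforward _ _ _ _ _ _ (measurable_aff t b)
  (@lebesgue_measure R) setT f measurableT mf (fun y _ => f0 y).
rewrite preimage_setT => <-.
rewrite -(ge0_integral_mscale _ measurableT k mf) //.
by apply: eq_measure_integral => A mA _; exact: lebesgue_aff.
Qed.

(** Up to transport along [consrV], slicing is the definition of the product measure. *)
Lemma vol_section n (X : set 'rV[R]_n.+1) : measurable X ->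
  vol X = (\int[lebesgue_measure]_x vol [set v | X (consrV (x, v))])%E.
Proof.
move=> mX; rewrite /= /lebesgue_step /pushforward /product_measure1.
by apply: eq_integral => x _ /=; congr (vol _); rewrite xsectionE.
Qed.

Lemma measurable_section n (X : set 'rV[R]_n.+1) x : measurable X ->
  measurable [set v | X (consrV (x, v))].
Proof.
move=> mX.
rewrite (_ : [set v | _] = xsection (@consrV _ n @^-1` X) x); last by rewrite xsectionE.
apply: measurable_xsection.
by rewrite -[X in measurable X]setTI; exact: measurable_consrV.
Qed.

Lemma measurable_vol_section n (X : set 'rV[R]_n.+1) : measurable X ->
  measurable_fun setT (fun x : measurableTypeR R =>
    vol [set v | X (consrV (x, v))]).
Proof.
move=> mX.
rewrite (_ : (fun x : R => _) = vol \o xsection (@consrV _ n @^-1` X)).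
  apply: measurable_fun_xsection.
  by rewrite -[X in measurable X]setTI; exact: measurable_consrV.
by apply/funext => x /=; rewrite xsectionE.
Qed.

Lemma measurable_affine m n (T : 'M[R]_(m, n)) (b : 'rV[R]_n) :
  measurable_fun setT (fun y : 'rV[R]_m => y *m T + b).
Proof.
apply/measurable_fun_rVP => i.
rewrite (_ : (fun _ => _) = (fun y : 'rV[R]_m => \sum_j y 0 j * T j i + b 0 i)); last first.
  by apply/funext => y; rewrite !mxE.
apply: measurable_funD => //; apply: measurable_sum => j.
by apply: measurable_funM => //; exact: measurable_coord.
Qed.

(** Induction on the dimension. As [T] is upper triangular, the first coordinate of [y *m T + b]
    depends only on that of [y]. Each slice is thus transformed by the block [T'] and a translation
    depending on [x], which leaves a one-dimensional change of variables in the outer integral. *)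
Lemma vol_preimage_affine n (T : 'M[R]_n) (b : 'rV[R]_n) (X : set 'rV[R]_n) :
  is_trig_mx T^T -> (forall i, 0 < T i i) -> measurable X ->
  vol X = ((\prod_i T i i)%:E * vol [set y | X (y *m T + b)%R])%E.
Proof.
elim: n T b X => [|n IHn] T b X trigT T0 mX.
  rewrite big_ord0 mul1e; congr (vol _); apply/seteqP; split => y /=;
  by rewrite (_ : y *m T + b = y) //; apply/rowP => -[].
pose t := T 0 0; pose b0 := b 0 0.
pose T' : 'M[R]_n := drsubmx (T : 'M[R]_(1 + n)).
pose r : 'rV[R]_n := ursubmx (T : 'M[R]_(1 + n)).
pose b' : 'rV[R]_n := rsubmx (b : 'rV_(1 + n)).
have affE x v : (consrV (x, v) : 'rV_n.+1) *m T + b =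
    consrV (x * t + b0, v *m T' + (x *: r + b')).
  have -> : T = block_mx t%:M r 0 T' :> 'M[R]_(1 + n).
    rewrite -[LHS](@submxK _ 1 n 1 n); congr block_mx.
      by rewrite [LHS]mx11_scalar !mxE; congr (T _ _)%:M; exact/val_inj.
    apply/matrixP => i j; rewrite !mxE.
    have /is_trig_mxP/(_ (lshift n j) (rshift 1 i)) := trigT.
    by rewrite mxE => -> //; rewrite ord1.
  have -> : b = row_mx b0%:M b' :> 'rV_(1 + n).
    rewrite -[LHS](@hsubmxK _ 1 1 n); congr row_mx.
    by rewrite [LHS]mx11_scalar !mxE; congr (b _ _)%:M; exact/val_inj.
  rewrite /consrV /= (@mul_row_block _ 1 1 n 1 n) (@add_row_mx _ 1 1 n).
  rewrite mulmx0 addr0 -scalar_mxM -raddfD mul_scalar_mx.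
  by rewrite [x *: r + v *m _]addrC -addrA.
have t0 : 0 < t by exact: T0.
have mX' : measurable [set y : 'rV[R]_n.+1 | X (y *m T + b)].
  rewrite -[X in measurable X]setTI.
  exact: (measurable_affine T b measurableT mX).
rewrite (vol_section mX) (vol_section mX').
rewrite (integral_aff b0 t0 (measurable_vol_section mX)); last first.
  by move=> x; exact: measure_ge0.
have T'0 i : 0 < T' i i by rewrite !mxE; exact: T0.
have trigT' : is_trig_mx T'^T.
  apply/is_trig_mxP => i j ij; rewrite !mxE.
  have /is_trig_mxP/(_ (rshift 1 i) (rshift 1 j)) := trigT.
  by rewrite mxE; apply; rewrite /= ltn_add2l.
have secE x : (vol [set v | X (consrV (x * t + b0, v))%R] =
    (\prod_i T' i i)%:E * vol [set v | X (consrV (x, v) *m T + b)%R])%E.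
  rewrite (IHn T' (x *: r + b') _ trigT' T'0 (measurable_section _ mX)).
  by congr (_ * vol _)%E; apply/funext => v /=; rewrite affE.
under eq_integral do rewrite secE.
rewrite ge0_integralZl//; last 2 first.
- exact: (measurable_vol_section mX').
- by rewrite lee_fin; apply: prodr_ge0 => i _; exact/ltW.
rewrite muleA -EFinM big_ord_recl; congr ((_ * _)%:E * _)%E.
by apply: eq_bigr => i _; rewrite !mxE; congr (T _ _); exact/val_inj.
Qed.

End affine_volume.

(** * Dot product and QR decomposition *)

Section dot_product.
Context {R : rcfType}.

Definition dot n (x y : 'rV[R]_n) : R := \sum_i x 0 i * y 0 i.

Lemma dotE n (x y : 'rV[R]_n) : dot x y = (x *m y^T) 0 0.
Proof. by rewrite mxE; apply: eq_bigr => i _; rewrite mxE. Qed.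

Lemma dotC n (x y : 'rV[R]_n) : dot x y = dot y x.
Proof. by apply: eq_bigr => i _; rewrite mulrC. Qed.

Lemma dotDl n (x y z : 'rV[R]_n) : dot (x + y) z = dot x z + dot y z.
Proof. by rewrite !dotE mulmxDl mxE. Qed.

Lemma dotZl n a (x y : 'rV[R]_n) : dot (a *: x) y = a * dot x y.
Proof. by rewrite !dotE -scalemxAl mxE. Qed.

Lemma dotNl n (x y : 'rV[R]_n) : dot (- x) y = - dot x y.
Proof. by rewrite !dotE mulNmx mxE. Qed.

Lemma dotBl n (x y z : 'rV[R]_n) : dot (x - y) z = dot x z - dot y z.
Proof. by rewrite dotDl dotNl. Qed.

Lemma dotBr n (x y z : 'rV[R]_n) : dot z (x - y) = dot z x - dot z y.
Proof. by rewrite dotC dotBl !(dotC z). Qed.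

Lemma dot_suml n (I : finType) (F : I -> 'rV[R]_n) y :
  dot (\sum_i F i) y = \sum_i dot (F i) y.
Proof. by rewrite dotE mulmx_suml summxE; apply: eq_bigr => i _; rewrite dotE. Qed.

Lemma dot_sumr n (I : finType) (F : I -> 'rV[R]_n) x :
  dot x (\sum_i F i) = \sum_i dot x (F i).
Proof. by rewrite dotC dot_suml; apply: eq_bigr => i _; rewrite dotC. Qed.

Lemma dot0l n (y : 'rV[R]_n) : dot 0 y = 0.
Proof. by rewrite dotE mul0mx mxE. Qed.

Lemma dotr0 n (y : 'rV[R]_n) : dot y 0 = 0.
Proof. by rewrite dotC dot0l. Qed.

Lemma dotxx_eq0 n (x : 'rV[R]_n) : (dot x x == 0) = (x == 0).
Proof.
apply/eqP/eqP => [x0|->]; last exact: dot0l.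
apply/rowP => i; apply/eqP; rewrite mxE -sqrf_eq0 expr2.
by move: x0 => /psumr_eq0P => -> // j _; rewrite -expr2 sqr_ge0.
Qed.

Lemma dotxx_ge0 n (x : 'rV[R]_n) : 0 <= dot x x.
Proof. by apply: sumr_ge0 => i _; rewrite -expr2 sqr_ge0. Qed.

Lemma dotxxZ n a (x : 'rV[R]_n) : dot (a *: x) (a *: x) = a ^+ 2 * dot x x.
Proof. by rewrite dotZl dotC dotZl mulrA expr2. Qed.

Lemma dot_orthogonal n (Q : 'M[R]_n) (x : 'rV[R]_n) :
  Q *m Q^T = 1%:M -> dot (x *m Q) (x *m Q) = dot x x.
Proof. by move=> QQ; rewrite !dotE trmx_mul mulmxA -(mulmxA x) QQ mulmx1. Qed.

(** Householder reflection in the hyperplane orthogonal to [z = v - w]. Equality of the norms gives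
    <v, z> = <z, z> / 2, so [v] is sent to [v - z = w]. *)
Lemma reflection_exists n (v w : 'rV[R]_n) : dot v v = dot w w ->
  exists2 H : 'M[R]_n, H *m H^T = 1%:M & v *m H = w.
Proof.
move=> vw; have [->|vNw] := eqVneq v w.
  by exists 1%:M; rewrite ?trmx1 mulmx1.
have [z zE] : exists z, z = v - w by exists (v - w).
set c := dot z z.
have c0 : c != 0 by rewrite dotxx_eq0 zE subr_eq0.
have zz : z *m z^T = c%:M by rewrite [LHS]mx11_scalar -dotE.
have vz : v *m z^T = (c / 2)%:M.
  rewrite [LHS]mx11_scalar -dotE; congr _%:M.
  by rewrite /c zE !(dotBl, dotBr) vw (dotC w v); field.
have HT : (1%:M - (2 / c) *: (z^T *m z))^T = 1%:M - (2 / c) *: (z^T *m z).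
  by rewrite linearB /= linearZ /= trmx1 trmx_mul trmxK.
exists (1%:M - (2 / c) *: (z^T *m z)).
  rewrite HT mulmxBl mul1mx mulmxBr mulmx1 -scalemxAl -scalemxAr scalerA.
  rewrite mulmxA -(mulmxA _ z) zz mul_mx_scalar -scalemxAl scalerA.
  rewrite -[RHS]subr0 -addrA -opprD; congr (_ - _).
  rewrite -scalerBl -scalerDl (_ : _ + _ = 0) ?scale0r//.
  by field.
rewrite mulmxBr mulmx1 -scalemxAr mulmxA vz mul_scalar_mx scalerA.
by rewrite (_ : _ * _ = 1) ?scale1r ?zE ?subKr//; field; rewrite c0.
Qed.

(* is_trig_mx means lower triangular, so T below is upper triangular. *)
Lemma qr_decomposition n (A : 'M[R]_n) : A \in unitmx ->
  exists Q T : 'M[R]_n, [/\ A = Q *m T, Q *m Q^T = 1%:M,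
    is_trig_mx T^T & forall i, 0 < T i i].
Proof.
elim: n A => [|n IHn] A uA.
  exists 1%:M, A; split; rewrite ?mul1mx ?trmx1//; last by case.
  by apply/is_trig_mxP => -[].
pose v := (col 0 A)^T; pose d := Num.sqrt (dot v v).
have v0 : v != 0.
  apply: contraTneq uA => v0; rewrite unitmxE unitfE negbK.
  rewrite (expand_det_col _ 0) big1// => i _.
  by have /rowP/(_ i) := v0; rewrite !mxE => ->; rewrite mul0r.
have d0 : 0 < d by rewrite sqrtr_gt0 lt_def dotxx_eq0 v0 dotxx_ge0.
(* The reflection takes the first column of [A] to a positive multiple of the first basis vector, so
   [H^T *m A] is block upper triangular and the induction continues on its lower right block. *)
pose w : 'rV[R]_n.+1 := d *: delta_mx 0 0.
have /reflection_exists[H HH vH] : dot v v = dot w w.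
  rewrite /w dotxxZ sqr_sqrtr ?dotxx_ge0// (_ : dot (delta_mx _ _) _ = 1) ?mulr1//.
  rewrite /dot (bigD1 0)//= !mxE !eqxx mulr1 big1 ?addr0// => i i0.
  by rewrite !mxE (negbTE i0) mul0r.
have HH' : H^T *m H = 1%:M by exact: mulmx1C.
have [M MHA] : exists M : 'M[R]_(1 + n), M = H^T *m A by exists (H^T *m A).
have uM : (M : 'M[R]_n.+1) \in unitmx.
  rewrite MHA unitmx_mul uA andbT.
  by have := mulmx1_unit HH' => -[].
have M0 i : M i 0 = d * (i == 0)%:R.
  have /rowP/(_ i) := vH; rewrite MHA /w !mxE eqxx /= => <-.
  by apply: eq_bigr => j _; rewrite !mxE mulrC.
pose A' := drsubmx M; pose r := ursubmx M.
have ME : M = block_mx d%:M r 0 A'.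
  rewrite -[LHS]submxK; congr block_mx.
    rewrite [LHS]mx11_scalar !mxE; congr _%:M.
    by rewrite -[RHS]mulr1 -[RHS](M0 0); congr (M _ _); exact/val_inj.
  apply/matrixP => i j; rewrite !mxE ord1.
  by rewrite -[RHS](mulr0 d) -[RHS](M0 (rshift 1 i)); congr (M _ _);
    exact/val_inj.
have /IHn[Q' [T' [A'E Q'Q' trigT' T'0]]] : A' \in unitmx.
  move: uM; rewrite !unitmxE ME (@det_ublock _ 1 n) det_scalar1.
  by rewrite unitrM => /andP[].
exists (H *m (block_mx 1%:M 0 0 Q' : 'M[R]_(1 + n))),
  (block_mx d%:M r 0 T' : 'M[R]_(1 + n)).
split.
- rewrite -mulmxA (@mulmx_block _ 1 n 1 n 1 n) !mul0mx !mul1mx !mulmx0 !addr0.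
  by rewrite !add0r -A'E -ME MHA mulmxA HH mul1mx.
- rewrite trmx_mul mulmxA -(mulmxA H) (@tr_block_mx _ 1 n 1 n).
  rewrite (@mulmx_block _ 1 n 1 n 1 n) !trmx1 !trmx0.
  rewrite !mul0mx !mul1mx !mulmx0 !addr0 !add0r Q'Q'.
  by rewrite -(@scalar_mx_block _ 1 n) mulmx1.
- rewrite (@tr_block_mx _ 1 n 1 n) (@is_trig_block_mx _ 1 n 1 n)// trmx0 eqxx trigT'.
  by rewrite mx11_is_trig.
- move=> i; have [j|j] := split_ordP (i : 'I_(1 + n)) => ->.
    by rewrite (@block_mxEul _ 1 n 1 n) ord1 mxE eqxx mulr1n.
  by rewrite (@block_mxEdr _ 1 n 1 n).
Qed.

End dot_product.

(** * Ellipsoids and the regular simplex *)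

Section ellipsoid_volume.
Context {R : realType}.

Lemma measurable_dot n (y : 'rV[R]_n) : measurable_fun setT (fun x => dot x y).
Proof.
by apply: measurable_sum => i; apply: measurable_funM => //; exact: measurable_coord.
Qed.

Lemma unit_ballE n (x : 'rV[R]_n) : euclidean_unit_ball x = (dot x x <= 1).
Proof.
by rewrite /euclidean_unit_ball /=; congr (is_true (_ <= _));
  apply: eq_bigr => i _; rewrite expr2.
Qed.

Lemma measurable_le_cst d (T : measurableType d) (f : T -> R) (c : R) :
  measurable_fun setT f -> measurable [set x | f x <= c].
Proof.
move=> mf; rewrite -[X in measurable X]setTI.
rewrite (_ : [set x | _] = f @^-1` `]-oo, c]%classic); first exact: mf.
by apply/seteqP; split=> x /=; rewrite in_itv.
Qed.

Definition polyhedron (I : Type) n (v : I -> 'rV[R]_n) (r : I -> R) :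
  set 'rV[R]_n := [set x | forall i, dot x (v i) <= r i].

Lemma measurable_polyhedron (I : finType) n (v : I -> 'rV[R]_n) r :
  measurable (polyhedron v r).
Proof.
rewrite (_ : polyhedron v r = \bigcap_i [set x | dot x (v i) <= r i]).
  apply: fin_bigcap_measurable => [|i _]; first exact: finite_finset.
  by apply: measurable_le_cst; exact: measurable_dot.
by apply/seteqP; split=> x xK i; [move=> _; exact: xK|exact: (xK i Logic.I)].
Qed.

Lemma measurable_unit_ball n : measurable (@euclidean_unit_ball R n).
Proof.
apply: measurable_le_cst; apply: measurable_sum => i.
by apply: measurable_funX; exact: measurable_coord.
Qed.

Lemma ellipsoid_trig n (c : 'rV[R]_n) E : ellipsoid_centered_at c E ->
  exists T : 'M[R]_n, [/\ is_trig_mx T^T, forall i, 0 < T i i &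
    E = [set c + x *m T | x in euclidean_unit_ball]].
Proof.
move=> [A /qr_decomposition[Q [T [-> QQ trigT T0]]] ->].
exists T; split=> //; apply/seteqP; split=> _ [x xB <-].
  exists (x *m Q); last by rewrite mulmxA.
  by move: xB; rewrite !unit_ballE dot_orthogonal.
exists (x *m Q^T); last by rewrite mulmxA -(mulmxA x) (mulmx1C QQ) mulmx1.
move: xB; rewrite !unit_ballE dot_orthogonal// trmxK.
exact: mulmx1C.
Qed.

Lemma vol_ellipsoid_trig n (c : 'rV[R]_n) (T : 'M[R]_n) :
  is_trig_mx T^T -> (forall i, 0 < T i i) ->
  vol [set c + x *m T | x in euclidean_unit_ball] =
  ((\prod_i T i i)%:E * vol (@euclidean_unit_ball R n))%E.
Proof.
move=> trigT T0.
have uT : T \in unitmx.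
  rewrite unitmxE -det_tr det_trig// unitfE.
  by apply/prodf_neq0 => i _; rewrite mxE gt_eqF.
set E := [set _ | _ in _].
have ES x : E x = euclidean_unit_ball (x *m invmx T - c *m invmx T).
  apply/propext; split=> [[y yB <-]|xB].
    by rewrite -mulmxBl addrAC subrr add0r mulmxK.
  by eexists; first exact: xB; rewrite -mulmxBl mulmxKV// addrC subrK.
have mE : measurable E.
  rewrite (_ : E = (fun x => x *m invmx T + - (c *m invmx T)) @^-1`
    euclidean_unit_ball); last by apply/funext => x; rewrite ES.
  rewrite -[X in measurable X]setTI.
  by apply: measurable_affine => //; exact: measurable_unit_ball.
rewrite (vol_preimage_affine c trigT T0 mE); congr (_ * vol _)%E.
by apply/funext => x /=; rewrite ES -mulmxBl addrK mulmxK.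
Qed.

End ellipsoid_volume.

Section regular_simplex.
Context {R : realType} (N : nat).
Hypothesis N0 : (0 < N)%N.

(** The last clause is John's decomposition of the identity: the normals form a tight frame with
    constant 1 + 1/N. *)
Definition simplex_normals (u : 'I_N.+1 -> 'rV[R]_N) :=
  [/\ \sum_i u i = 0,
      forall i j, dot (u i) (u j) = (i == j)%:R * (1 + N%:R^-1) - N%:R^-1 &
      forall k l, \sum_i u i 0 k * u i 0 l = (k == l)%:R * (1 + N%:R^-1)].

Lemma simplex_normals_exist : exists u, simplex_normals u.
Proof.
pose n : R := N%:R.
have n0 : n != 0 by rewrite pnatr_eq0 -lt0n.
have n_gt0 : 0 < n by rewrite ltr0n.
pose s := Num.sqrt n^-1; pose a := Num.sqrt (1 + n^-1).
(* The vectors will be the rows of aI + bJ, with J the all-ones matrix, and the constant row -s.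
   This [b] makes every row of aI + bJ sum to [s], so its product with the constant row is -s^2 =
   -1/N. *)
have [b bE] : exists b, b * n = s - a by exists ((s - a) / n); rewrite divfK.
have ss : s * s = n^-1 by rewrite -expr2 sqr_sqrtr// invr_ge0 ltW.
have aa : a * a = 1 + n^-1.
  by rewrite -expr2 sqr_sqrtr// addr_ge0// invr_ge0 ltW.
(* Since aI + bJ is symmetric, this one computation serves both the Gram matrix and the tight frame
   identity. *)
have sumE (k l : 'I_N) :
    \sum_j (a * (j == k)%:R + b) * (a * (j == l)%:R + b) =
    (k == l)%:R * (1 + n^-1) - n^-1.
  transitivity (\sum_j (a * a * ((j == k)%:R * (j == l)%:R) +
      a * b * (j == k)%:R + a * b * (j == l)%:R + b * b)).
    by apply: eq_bigr => j _; ring.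
  rewrite !big_split /= -3!mulr_sumr sumr_const card_ord -[(b * b) *+ N]mulr_natr -/n.
  have s1 (i : 'I_N) : \sum_j (j == i)%:R = 1 :> R.
    by rewrite (bigD1 i)//= eqxx big1 ?addr0// => j /negbTE ->.
  rewrite !s1 (bigD1 k)//= eqxx mul1r big1 ?addr0; last first.
    by move=> j /negbTE ->; rewrite mul0r.
  rewrite aa !mulr1 -[RHS]addr0 -!addrA [_ * (k == l)%:R]mulrC; congr (_ + _).
  rewrite addr0 -mulrA bE.
  transitivity ((s * s - a * a) / n); last by rewrite ss aa; field.
  rewrite (_ : s * s - a * a = b * n * (s + a)); first by field.
  by rewrite bE; ring.
have sum1 (k : 'I_N) : \sum_j (a * (j == k)%:R + b) = s.
  rewrite big_split /= -mulr_sumr sumr_const card_ord -[b *+ N]mulr_natr -/n.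
  rewrite (bigD1 k)//= eqxx big1 ?addr0 => [|j /negbTE -> //].
  by rewrite bE mulr1; ring.
exists (fun i => if unlift ord0 i is Some k then \row_l (a * (l == k)%:R + b)
  else const_mx (- s)).
split=> [|i j|k l].
- rewrite big_ord_recl unlift_none; apply/rowP => k.
  rewrite mxE summxE !mxE; under eq_bigr => j _ do rewrite liftK mxE eq_sym.
  by rewrite sum1 addNr.
- rewrite /dot; case: unliftP => [i' ->|->]; case: unliftP => [j' ->|->].
  + rewrite (inj_eq lift_inj) -sumE.
    by apply: eq_bigr => k _; rewrite !mxE.
  + rewrite eq_sym (negbTE (neq_lift _ _)) mul0r add0r.
    under eq_bigr => k _ do rewrite !mxE.
    by rewrite -mulr_suml sum1 mulrN ss.
  + rewrite (negbTE (neq_lift _ _)) mul0r add0r.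
    under eq_bigr => k _ do rewrite !mxE.
    by rewrite -mulr_sumr sum1 mulNr ss.
  + under eq_bigr => k _ do rewrite !mxE.
    rewrite sumr_const card_ord eqxx mulrNN ss -[n^-1 *+ N]mulr_natr mul1r -/n.
    by field.
- rewrite big_ord_recl unlift_none !mxE mulrNN ss.
  under eq_bigr => j _ do rewrite liftK !mxE ![_ == j]eq_sym.
  by rewrite sumE; ring.
Qed.

Variable u : 'I_N.+1 -> 'rV[R]_N.
Hypothesis uP : simplex_normals u.

(** The weights are lower bounds on the y_i = 1 - <x, u_i>: zero weights give the circumscribed
    simplex S, others its homothetic copies. *)
Definition simplex (w : 'I_N.+1 -> R) : set 'rV[R]_N :=
  [set x | forall i, w i <= 1 - dot x (u i)].

Lemma measurable_simplex w : measurable (simplex w).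
Proof.
rewrite (_ : simplex w = polyhedron u (fun i => 1 - w i)).
  exact: measurable_polyhedron.
by apply/seteqP; split=> x xw i; have /= := xw i; lra.
Qed.

Lemma simplex_normal_norm i : dot (u i) (u i) = 1.
Proof. by have [_ -> _] := uP; rewrite eqxx mul1r addrK. Qed.

(** The y_i add up to N + 1, so subtracting the weights rescales this total, and with it the
    simplex, by the factor [t]. The center of the homothety exists because the required products
    [h i] with the normals add up to zero. *)
Lemma vol_simplex w : \sum_i w i < N.+1%:R ->
  vol (simplex w) = (((1 - (\sum_i w i) / N.+1%:R) ^+ N)%:E *
                     vol (simplex (fun=> 0%R)))%E.
Proof.
have [sum0 gram _] := uP; move=> wN; set t := 1 - _.
have n0 : N%:R != 0 :> R by rewrite pnatr_eq0 -lt0n.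
have n1 : N.+1%:R != 0 :> R by rewrite pnatr_eq0.
have n1' : N%:R + 1 != 0 :> R by rewrite natr1.
have t0 : 0 < t by rewrite subr_gt0 ltr_pdivrMr ?ltr0n// mul1r.
pose h i := 1 - t - w i.
have sumh : \sum_i h i = 0.
  rewrite big_split /= sumr_const card_ord sumrN -mulr_natr /t.
  by rewrite subKr divfK// subrr.
(* simplex w is the image of simplex 0 under y |-> t y + p. *)
pose p : 'rV[R]_N := \sum_j (N%:R / N.+1%:R * h j) *: u j.
have pE i : dot p (u i) = h i.
  rewrite dot_suml.
  under eq_bigr => j _ do rewrite dotZl gram mulrBr.
  rewrite big_split /= sumrN -mulr_suml -mulr_sumr sumh mulr0 mul0r subr0.
  rewrite (bigD1 i)//= eqxx big1 ?addr0 => [|j /negbTE ->]; last first.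
    by rewrite mul0r mulr0.
  by rewrite mul1r -natr1; field; rewrite n0 n1'.
have trigt : is_trig_mx (t%:M : 'M[R]_N)^T.
  by rewrite tr_scalar_mx scalar_mx_is_trig.
rewrite (vol_preimage_affine p trigt _ (measurable_simplex w)); last first.
  by move=> i; rewrite mxE eqxx.
have -> : [set y | simplex w (y *m t%:M + p)] = simplex (fun=> 0).
  apply/seteqP; split=> x xw i; move: (xw i);
    rewrite mul_mx_scalar dotDl dotZl pE /h.
    rewrite -subr_ge0 (_ : _ - _ = t * (1 - dot x (u i))) ?pmulr_rge0//.
    by ring.
  rewrite -(pmulr_rge0 _ t0) -[w i <= _]subr_ge0.
  by rewrite (_ : _ - w i = t * (1 - dot x (u i)))//; ring.
by under eq_bigr do rewrite mxE eqxx mulr1n; rewrite prodr_const card_ord.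
Qed.

(** With [T] triangular, the volume ratio is the product of the diagonal entries. Adding the N + 1
    constraints at suitable points of the ellipsoid eliminates [c], because the normals add up to
    zero, and the tight frame turns the rest into the trace of [T]. Hence the trace is at most N,
    and the inequality of arithmetic and geometric means concludes. *)
Lemma ellipsoid_in_simplex E : ellipsoid E -> E `<=` simplex (fun=> 0) ->
  (vol E <= vol (@euclidean_unit_ball R N))%E.
Proof.
have [sum0 gram tight] := uP.
move=> [c /ellipsoid_trig[T [trigT T0 ->]]] sub.
rewrite vol_ellipsoid_trig// -[leRHS]mul1e; apply: lee_wpmul2r.
  exact: measure_ge0.
rewrite lee_fin.
have n0 : N%:R != 0 :> R by rewrite pnatr_eq0 -lt0n.
have n_gt0 : 0 < N%:R :> R by rewrite ltr0n.
have trE : \sum_i dot (u i *m T) (u i) = (1 + N%:R^-1) * \sum_k T k k.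
  transitivity (\sum_i \sum_l \sum_k T k l * (u i 0 k * u i 0 l)).
    apply: eq_bigr => i _; apply: eq_bigr => l _; rewrite mxE mulr_suml.
    by apply: eq_bigr => k _; ring.
  rewrite exchange_big /= mulr_sumr; apply: eq_bigr => l _.
  rewrite exchange_big /=.
  under eq_bigr => k _ do rewrite -mulr_sumr tight.
  rewrite (bigD1 l)//= eqxx big1 ?addr0 => [|k /negbTE ->]; first by rewrite mul1r mulrC.
  by rewrite mul0r mulr0.
(* The points c + u_i T of E satisfy the i-th constraint of the simplex. *)
have trT : (\sum_k T k k) <= N%:R.
  have : 0 <= \sum_i (1 - dot (c + u i *m T) (u i)).
    apply: sumr_ge0 => i _; apply: (sub (c + u i *m T)).
    by exists (u i) => //; rewrite unit_ballE simplex_normal_norm.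
  rewrite big_split /= sumr_const card_ord sumrN.
  rewrite (eq_bigr _ (fun i _ => dotDl c (u i *m T) (u i))).
  rewrite big_split /= -dot_sumr sum0 dotr0 add0r trE subr_ge0 => H.
  rewrite -(@ler_pM2l _ (1 + N%:R^-1)) ?addr_gt0 ?invr_gt0//.
  by apply: (le_trans H); rewrite mulrDl mul1r mulVf// natr1.
have := @leif_AGM R 'I_N predT (fun i => T i i) (fun i _ => ltW (T0 i)).
rewrite card_ord => /leif_le /le_trans; apply.
rewrite exprn_ile1//.
  by rewrite divr_ge0// sumr_ge0// => i _; exact/ltW.
by rewrite ler_pdivrMr// mul1r.
Qed.

End regular_simplex.

(** * Polyhedra and cubes *)

Section polyhedra.
Context {R : realType}.

Lemma continuous_dot n (y : 'rV[R]_n) : continuous (fun x => dot x y).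
Proof.
rewrite /dot; elim: (index_enum _) => [|i s IHs] x.
  by under eq_fun do rewrite big_nil; exact: cst_continuous.
under eq_fun do rewrite big_cons.
apply: (@continuousD _ _ _ (fun x : 'rV[R]_n => x 0 i * y 0 i)); last exact: IHs.
have cx : {for x, continuous (fun z : 'rV[R]_n => z 0 i)}.
  exact: coord_continuous.
exact: (continuousM cx (@cst_continuous _ _ (y 0 i) x)).
Qed.

Lemma closed_polyhedron I n (v : I -> 'rV[R]_n) r : closed (polyhedron v r).
Proof.
rewrite (_ : polyhedron v r = \bigcap_i [set x | dot x (v i) <= r i]).
  apply: closed_bigI => i _; apply: (preimage_closed _ (@closed_le _ _)) => y _.
  exact: continuous_dot.
by apply/seteqP; split=> x xK i; [move=> _; exact: xK|exact: (xK i Logic.I)].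
Qed.

Lemma convex_polyhedron I n (v : I -> 'rV[R]_n) r : convex_set (polyhedron v r).
Proof.
move=> x y t; rewrite !inE => xK yK i.
have -> : conv t x y = t%:num *: (x : 'rV_n) + (1 - t%:num) *: (y : 'rV_n).
  by [].
rewrite dotDl !dotZl.
have t0 : 0 <= t%:num by [].
have t1 : t%:num <= 1 by [].
by have := xK i; have := yK i; nra.
Qed.

(** Cubes have an explicit volume; they serve as outer bounds for compactness, integrability and
    finite volume, and as inner ones for interior points and positive volume. *)
Definition cube n (a : R) : set 'rV[R]_n := [set x | forall i, `|x 0 i| <= a].
Arguments cube : clear implicits.

Lemma cube_nbhs n (a : R) : 0 < a -> nbhs (0 : 'rV[R]_n) (cube n a).
Proof.
move=> a0; apply/nbhs_ballP; exists a => //= x.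
rewrite -ball_normE /= sub0r normrN => xa i; apply/ltW/(le_lt_trans _ xa).
rewrite [leRHS]/Num.norm /= mx_normrE.
by apply/bigmax_geP; right => /=; exists (0, i).
Qed.

Lemma compact_cube n (a : R) : compact (cube n a).
Proof.
rewrite (_ : cube n a = [set x | forall i, `[(- a), a]%classic (x ord0 i)]).
  apply: (@rV_compact _ n (fun=> `[(- a), a]%classic)) => i.
  exact: segment_compact.
by apply/seteqP; split=> x xa i; have := xa i; rewrite /= in_itv /= ler_norml.
Qed.

Lemma measurable_cube n (a : R) : measurable (cube n a).
Proof.
rewrite (_ : cube n a = \bigcap_i [set x | `|x 0 i| <= a]).
  apply: fin_bigcap_measurable => [|i _]; first exact: finite_finset.
  apply: measurable_le_cst.
  by apply: measurableT_comp => //; exact: measurable_coord.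
by apply/seteqP; split=> x xK i; [move=> _; exact: xK|exact: (xK i Logic.I)].
Qed.

Lemma vol_cube n (a : R) : 0 < a -> vol (cube n a) = ((2 * a) ^+ n)%:E.
Proof.
move=> a0; elim: n => [|n IHn].
  rewrite /= diracE mem_set// => i; by case: i.
rewrite /= /lebesgue_step /pushforward.
have fstE (p : R * 'rV[R]_n) : consrV p 0 0 = p.1.
  exact: (congr1 fst (consrVK p)).
have sndE (p : R * 'rV[R]_n) i : consrV p 0 (rshift 1 i) = p.2 0 i.
  by have /(congr1 snd)/rowP/(_ i) := consrVK p; rewrite mxE.
rewrite (_ : _ @^-1` _ = `[(- a), a]%classic `*` cube n a); last first.
  apply/seteqP; split=> [p xv|p [/= xa va] i].
    split=> [|i] /=; last by rewrite -sndE; exact: xv.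
    by rewrite in_itv /= -ler_norml -fstE; exact: xv.
  have [j|j] := split_ordP (i : 'I_(1 + n)) => ->; last by rewrite sndE.
  rewrite (_ : lshift n j = 0 :> 'I_n.+1); last by rewrite ord1; exact/val_inj.
  by rewrite fstE; move: xa; rewrite in_itv /= ler_norml.
rewrite product_measure1E//; last exact: measurable_cube.
have itvE : lebesgue_measure `[(- a), a]%classic = (2 * a)%:E.
  rewrite lebesgue_measure_itv /= lte_fin gtrN// -EFinB.
  by congr EFin; ring.
by rewrite IHn exprS EFinM -itvE.
Qed.

End polyhedra.
Arguments cube {R}.

(** * The lopsided body *)

Section lopsided_body.
Context {R : realType} (N : nat) (u : 'I_N.+1 -> 'rV[R]_N).
Hypotheses (N9 : (9 <= N)%N) (uP : simplex_normals u).

Local Notation L := (N.+1%:R : R).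
Local Notation simplex0 := (simplex u (fun=> 0)).
Local Notation ball := (@euclidean_unit_ball R N).

Let N0 : (0 < N)%N. Proof. exact: leq_trans N9. Qed.

Let L10 : 10 <= L. Proof. by rewrite ler_nat. Qed.

Let LE : L = N%:R + 1. Proof. by rewrite natr1. Qed.

Definition free_pair (p : 'I_N.+1 * 'I_N.+1) :=
  [&& p.1 != ord0, p.2 != ord0 & p.1 != p.2].

(* With y_i = 1 - <x, u_i>, a free pair (i, j) encodes the inequality
   y_i + y_j >= (1 - 20 y_0 / L) / 2, and the other pairs encode y_i >= 0. *)
Definition lopsided : set 'rV[R]_N := polyhedron
  (fun p => if free_pair p then u p.1 + u p.2 + (10 / L) *: u ord0 else u p.1)
  (fun p => if free_pair p then 3 / 2 + 10 / L else 1).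

Lemma lopsidedP x : lopsided x <-> simplex0 x /\
  forall i j, free_pair (i, j) ->
    dot x (u i) + dot x (u j) <= 3 / 2 + 10 / L * (1 - dot x (u ord0)).
Proof.
have dotE i j : dot x (u i + u j + (10 / L) *: u ord0) =
    dot x (u i) + dot x (u j) + 10 / L * dot x (u ord0).
  by rewrite dotC !dotDl dotZl !(dotC _ x).
split=> [xK|[xS xK] [i j]].
  split=> [i|i j ij]; last first.
    have := xK (i, j); rewrite ij /= dotE.
    by move: (10 / L) => h; lra.
  have := xK (i, i); rewrite /free_pair /= eqxx !andbF.
  by rewrite subr_ge0.
case: ifPn => ij; first by have := xK i j ij; rewrite dotE /=; move: (10 / L) => h; lra.
by have := xS i; rewrite subr_ge0.
Qed.

(** Parseval's identity for the tight frame of normals. *)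
Lemma sum_sqr_dot x : \sum_i dot x (u i) ^+ 2 = (1 + N%:R^-1) * dot x x.
Proof.
have [_ _ tight] := uP.
transitivity (\sum_i \sum_k \sum_l x 0 k * x 0 l * (u i 0 k * u i 0 l)).
  apply: eq_bigr => i _; rewrite expr2 mulr_suml; apply: eq_bigr => k _.
  by rewrite mulr_sumr; apply: eq_bigr => l _; ring.
rewrite exchange_big mulr_sumr; apply: eq_bigr => k _.
rewrite exchange_big /=; under eq_bigr => l _ do rewrite -mulr_sumr tight.
rewrite (bigD1 k)//= eqxx big1 ?addr0 => [|l]; first by rewrite mul1r mulrC.
by rewrite eq_sym => /negbTE ->; rewrite mul0r mulr0.
Qed.

(** One term of Parseval's identity, with 1 + 1/N bounded by 2. It limits the height y_0 on a scaled
    ball. *)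
Lemma sqr_dot_le x i : dot x (u i) ^+ 2 <= 2 * dot x x.
Proof.
apply: (@le_trans _ _ (\sum_i dot x (u i) ^+ 2)).
  by rewrite (bigD1 i)//= lerDl sumr_ge0// => j _; rewrite sqr_ge0.
rewrite sum_sqr_dot ler_wpM2r ?dotxx_ge0// lerD2l.
by rewrite invf_le1 ?ler1n ?ltr0n.
Qed.

(** For two distinct normals, Parseval's identity gives a^2 + b^2 <= 1 + 1/N <= 9/8, hence a + b <=
    3/2. This is the pair constraint at y_0 = 0, and y_0 >= 0 only relaxes it. *)
Lemma unit_ball_lopsided : ball `<=` lopsided.
Proof.
move=> x; rewrite unit_ballE => x1; apply/lopsidedP.
have s1 : \sum_i dot x (u i) ^+ 2 <= 9 / 8.
  rewrite sum_sqr_dot; apply: (@le_trans _ _ (1 + N%:R^-1)).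
    by rewrite ler_piMr// addr_ge0.
  have : (N%:R : R)^-1 <= 8^-1.
    by rewrite lef_pV2 ?posrE ?ltr0n// ler_nat (leq_trans _ N9).
  by lra.
have x_le1 i : dot x (u i) <= 1.
  have n_gt0 : 0 < N%:R :> R by rewrite ltr0n.
  have [sum0 _ _] := uP.
  rewrite -subr_ge0 -(@pmulr_rge0 _ 2)//.
  have : 0 <= dot (x - u i) (x - u i) by exact: dotxx_ge0.
  rewrite !(dotBl, dotBr) (dotC (u i) x) (simplex_normal_norm uP).
  by lra.
split=> [i|i j /and3P[/= i0 j0 ij]]; first by rewrite subr_ge0.
apply: (@le_trans _ _ (3 / 2)); last first.
  by rewrite lerDl mulr_ge0 ?subr_ge0// divr_ge0.
move: s1; rewrite (bigD1 i)//= (bigD1 j) 1?eq_sym//= => s1.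
set a := dot x (u i) in s1 *; set b := dot x (u j) in s1 *.
have : a ^+ 2 + b ^+ 2 <= 9 / 8.
  apply: le_trans s1; rewrite addrA lerDl sumr_ge0// => k _.
  by rewrite sqr_ge0.
have := sqr_ge0 (a - b); nra.
Qed.

Lemma simplex0_bounded : exists2 D : R, 0 < D & simplex0 `<=` cube N D.
Proof.
have [sum0 _ _] := uP.
have L0 : 0 < L by rewrite ltr0n.
(* The y_i are nonnegative with sum [L], so each <x, u_i>^2 is at most L^2 and Parseval's identity
   bounds |x|^2 by L^3. The extra 1 passes from the square of a coordinate to its absolute value. *)
exists (L * L ^+ 2 + 1) => [|x xS k].
  by rewrite ltr_wpDl// mulr_ge0// ?sqr_ge0.
have sum1 : \sum_i (1 - dot x (u i)) = L.
  by rewrite big_split /= sumr_const card_ord sumrN -dot_sumr sum0 dotr0 subr0.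
have dx i : dot x (u i) ^+ 2 <= L ^+ 2.
  have h : 1 - dot x (u i) <= L.
    rewrite -sum1 (bigD1 i)//= lerDl sumr_ge0// => j _; exact: xS.
  have := xS i; rewrite -subr_ge0 => h0.
  by have := L10; nra.
have xx : dot x x <= L * L ^+ 2.
  apply: (@le_trans _ _ (\sum_i dot x (u i) ^+ 2)).
    by rewrite sum_sqr_dot ler_peMl ?dotxx_ge0// lerDl invr_ge0.
  apply: (@le_trans _ _ (\sum_(i < N.+1) L ^+ 2)); first exact: ler_sum.
  by rewrite sumr_const card_ord -[leLHS]mulr_natl.
have : x 0 k ^+ 2 <= dot x x.
  rewrite /dot (bigD1 k)//= -expr2 lerDl sumr_ge0// => j _.
  by rewrite -expr2 sqr_ge0.
rewrite -real_normK ?num_real// => h.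
have := sqr_ge0 (`|x 0 k| - 1); have := normr_ge0 (x 0 k); nra.
Qed.

Lemma cube_unit_ball : cube N N%:R^-1 `<=` ball.
Proof.
move=> x xa; rewrite unit_ballE.
apply: (@le_trans _ _ (\sum_(i < N) N%:R^-1)).
  apply: ler_sum => i _; rewrite -expr2 -real_normK ?num_real//.
  apply: (@le_trans _ _ (N%:R^-1 ^+ 2)).
    by rewrite lerXn2r ?nnegrE//; exact: xa.
  by rewrite expr2 ler_piMr// invf_le1 ?ler1n ?ltr0n.
by rewrite sumr_const card_ord -[leLHS]mulr_natl divff// pnatr_eq0 -lt0n.
Qed.

Lemma convex_body_lopsided : convex_body lopsided.
Proof.
split; first exact: convex_polyhedron.
  have [D _ SD] := simplex0_bounded.
  apply: (subclosed_compact (@closed_polyhedron _ _ _ _ _) (@compact_cube _ N D)).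
  by move=> x /lopsidedP[/SD].
exists 0; rewrite /interior.
apply: (@filterS _ _ _ (cube N N%:R^-1)).
  by move=> x /cube_unit_ball/unit_ball_lopsided.
by apply: cube_nbhs; rewrite invr_gt0 ltr0n.
Qed.

Lemma ellipsoid_centered_at_unit_ball : ellipsoid_centered_at 0 ball.
Proof.
exists 1%:M; first exact: unitmx1.
by under eq_imagel do rewrite mulmx1 add0r; rewrite image_id.
Qed.

(** The unit ball is already maximal among the ellipsoids of the larger simplex. *)
Lemma john_ellipsoid_lopsided : john_ellipsoid lopsided ball.
Proof.
split; last 2 first.
- exact: unit_ball_lopsided.
- move=> E eE EK; apply: (ellipsoid_in_simplex N0 uP eE).
  by move=> x /EK/lopsidedP[].
by exists 0; exact: ellipsoid_centered_at_unit_ball.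
Qed.

Lemma vol_simplex0_fin : vol simplex0 \is a fin_num.
Proof.
have [D D0 SD] := simplex0_bounded.
rewrite ge0_fin_numE; last exact: measure_ge0.
apply: (@le_lt_trans _ _ (vol (cube N D))); last by rewrite vol_cube// ltry.
apply: le_measure SD; rewrite inE; first exact: measurable_simplex.
exact: measurable_cube.
Qed.

Lemma vol_simplex0_gt0 : (0 < vol simplex0)%E.
Proof.
apply: (@lt_le_trans _ _ (vol (cube N N%:R^-1))).
  by rewrite vol_cube ?invr_gt0 ?ltr0n// lte_fin exprn_gt0// mulr_gt0// invr_gt0 ltr0n.
apply: le_measure; rewrite ?inE; first exact: measurable_cube.
  exact: measurable_simplex.
by move=> x /cube_unit_ball/unit_ball_lopsided/lopsidedP[].
Qed.

(** Where y_0 >= L/20 the right-hand side (1 - 20 y_0 / L) / 2 of the pair constraints is at most 0,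
    so they follow from y_i >= 0. *)
Lemma vol_lopsided_ge : (((19 / 20) ^+ N)%:E * vol simplex0 <= vol lopsided)%E.
Proof.
have L0 : L != 0 by rewrite pnatr_eq0.
pose w (i : 'I_N.+1) : R := if i == ord0 then L / 20 else 0.
have sw : \sum_i w i = L / 20.
  by rewrite (bigD1 ord0)//= /w eqxx big1 ?addr0// => i /negbTE ->.
have -> : 19 / 20 = 1 - (\sum_i w i) / L by rewrite sw; field.
rewrite -(vol_simplex N0 uP); last by rewrite sw; have := L10; lra.
apply: le_measure; rewrite ?inE; first exact: measurable_simplex.
  exact: measurable_polyhedron.
move=> x xw; apply/lopsidedP.
have w0 i : 0 <= w i by rewrite /w; case: ifP => // _; have := L10; lra.
have xS : simplex0 x by move=> i; exact: le_trans (xw i).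
split=> // i j _.
have := xw ord0; rewrite /w eqxx => h.
have : 10 / L * (L / 20) <= 10 / L * (1 - dot x (u ord0)).
  by rewrite ler_wpM2l// divr_ge0.
rewrite (_ : 10 / L * (L / 20) = 1 / 2); last by field.
move: (10 / L * _) => q hq.
by have /= := xS i; have /= := xS j; lra.
Qed.

(** The cut-off is half of the height L/20 at which the pair constraints become void; below it they
    still force y_i + y_j >= 1/4. *)
Definition lopsided_low : set 'rV[R]_N :=
  lopsided `&` [set x | 1 - dot x (u ord0) <= L / 40].

Lemma measurable_lopsided_low : measurable lopsided_low.
Proof.
apply: measurableI; first exact: measurable_polyhedron.
apply: measurable_le_cst; apply: measurable_funB => //.
exact: measurable_dot.
Qed.

(** Union bound over the exceptional index: each of the N + 1 pieces lies in a copy of the simplex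
    of ratio at most 9/10. *)
Lemma vol_lopsided_low :
  (vol lopsided_low <= (L * (9 / 10) ^+ N)%:E * vol simplex0)%E.
Proof.
have L0 : 0 < L by rewrite ltr0n.
pose w (j i : 'I_N.+1) : R :=
  if (i == ord0) || (i == j) then 0 else 8^-1.
have cover : lopsided_low `<=`
    \big[setU/set0]_(k < N.+1) simplex u (w (inord k)).
  move=> x [/lopsidedP[xS xK] /= low].
  have low' : 10 / L * (1 - dot x (u ord0)) <= 1 / 4.
    have -> : 1 / 4 = 10 / L * (L / 40) by field; rewrite gt_eqF.
    by rewrite ler_wpM2l// divr_ge0.
  (* Two of the y_k, k > 0, add up to at least 1/4, so at most one is below 1/8;
     j = 0 stands for no exception. *)
  have [j jP] : exists j, forall k, k != ord0 -> k != j ->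
      8^-1 <= 1 - dot x (u k).
    have [[j [j0 jlt]]|none] := pselect
      (exists j, j != ord0 /\ 1 - dot x (u j) < 8^-1).
      exists j => k k0 kj.
      have /xK : free_pair (k, j) by rewrite /free_pair /= k0 j0 kj.
      by move: low' jlt; move: (10 / L * _) => q; lra.
    exists ord0 => k k0 _; rewrite leNgt; apply/negP => klt.
    by apply: none; exists k.
  rewrite -(bigcup_mkord N.+1 (fun k => simplex u (w (inord k)))); exists j => //=; rewrite inord_val => k.
  rewrite /w; case: ifPn => [_|]; first exact: xS.
  by rewrite negb_or => /andP[]; exact: jP.
apply: (@le_trans _ _ (\sum_(k < N.+1) vol (simplex u (w (inord k))))%E).
  apply: (@content_subadditive _ _ _ vol lopsided_low
    (fun k => simplex u (w (inord k)))) => // [k _|].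
    exact: measurable_simplex.
  exact: measurable_lopsided_low.
have Ew : (\sum_(k < N.+1) ((9 / 10) ^+ N)%:E * vol simplex0 =
    (L * (9 / 10) ^+ N)%:E * vol simplex0)%E.
  by rewrite -[vol _]fineK ?vol_simplex0_fin// -EFinM sumEFin sumr_const
    card_ord -EFinM -[_ *+ _]mulr_natl mulrA.
rewrite -Ew; apply: lee_sum => k _.
set j := inord k.
(* Subtracting the two indicators separately also covers j = 0. The weights then add up to at least
   (L - 2) / 8, which is at least L/10 because L >= 10. *)
have w_ge i : 8^-1 - 8^-1 * ((i == ord0)%:R + (i == j)%:R) <= w j i.
  by rewrite /w; case: eqP; case: eqP => //=; lra.
have w_le i : w j i <= 8^-1 by rewrite /w; case: ifP => // _; lra.
have s1 (i : 'I_N.+1) : \sum_j (j == i)%:R = 1 :> R.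
  by rewrite (bigD1 i)//= eqxx big1 ?addr0// => l /negbTE ->.
have swL : L / 10 <= \sum_i w j i.
  apply: le_trans (ler_sum _ (fun i _ => w_ge i)).
  rewrite sumrB sumr_const card_ord -mulr_sumr big_split /= !s1.
  by rewrite -[_ *+ _]mulr_natr; have := L10; lra.
(* Keeps the ratio of the copy positive, as [vol_simplex] and monotonicity of the power require. *)
have swU : \sum_i w j i <= L / 8.
  apply: le_trans (ler_sum _ (fun i _ => w_le i)) _.
  by rewrite sumr_const card_ord -[8^-1 *+ N.+1]mulr_natl.
rewrite (vol_simplex N0 uP); last by lra.
apply: lee_wpmul2r; first exact: measure_ge0.
have q_le : (\sum_i w j i) / L <= 1 by rewrite ler_pdivrMr//; lra.
have q_ge : 10^-1 <= (\sum_i w j i) / L by rewrite ler_pdivlMr//; lra.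
move: (_ / L) q_le q_ge => q q_le q_ge.
by rewrite lee_fin; apply: lerXn2r; rewrite ?nnegrE; lra.
Qed.

End lopsided_body.

(** * Center of mass and linear functionals *)

Section centroid.
Context {R : realType}.

Lemma Rintegral_sum d (T : measurableType d) (mu : {measure set T -> \bar R})
    (D : set T) (I : Type) (s : seq I) (f : I -> T -> R) : measurable D ->
  (forall i, mu.-integrable D (EFin \o f i)) ->
  \int[mu]_(x in D) (\sum_(i <- s) f i x) =
  \sum_(i <- s) \int[mu]_(x in D) f i x.
Proof.
move=> mD intf; elim: s => [|i s IHs].
  rewrite big_nil; under eq_Rintegral do rewrite big_nil.
  by rewrite Rintegral_cst// mul0r.
rewrite big_cons -IHs; under eq_Rintegral do rewrite big_cons.
apply: RintegralD => //.
rewrite (_ : _ \o _ = fun x => (\sum_(j <- s) (f j x)%:E)%E).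
  by apply: integrable_sum => // j _; exact: intf.
by apply/funext => x; rewrite /= sumEFin.
Qed.

Lemma integrable_coord n (K : set 'rV[R]_n) D i : measurable K ->
  (vol K < +oo)%E -> K `<=` cube n D ->
  vol.-integrable K (EFin \o (fun x : 'rV[R]_n => x 0 i)).
Proof.
move=> mK Koo KD; apply: measurable_bounded_integrable => //.
  by apply: measurable_funTS; exact: measurable_coord.
exists D; split; first exact: num_real.
by move=> M DM x /KD /(_ i) xD; apply: le_trans xD _; exact: ltW.
Qed.

Lemma dot_center_of_mass n (K : set 'rV[R]_n) D y : measurable K ->
  (vol K < +oo)%E -> K `<=` cube n D ->
  dot (center_of_mass K) y = (fine (vol K))^-1 * \int[vol]_(x in K) dot x y.
Proof.
move=> mK Koo KD; have intK i := integrable_coord i mK Koo KD.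
rewrite Rintegral_sum// => [|i]; last first.
  rewrite (_ : _ \o _ = fun x : 'rV[R]_n => ((y 0 i)%:E * (x 0 i)%:E)%E).
    by apply: integrableZl => //; exact: intK.
  by apply/funext => x; rewrite /= mulrC EFinM.
rewrite mulr_sumr; apply: eq_bigr => i _.
by rewrite mxE RintegralZr// mulrA.
Qed.

Lemma integrable_dot n (K : set 'rV[R]_n) D y : measurable K ->
  (vol K < +oo)%E -> K `<=` cube n D ->
  vol.-integrable K (EFin \o (fun x => dot x y)).
Proof.
move=> mK Koo KD; have intK i := integrable_coord i mK Koo KD.
rewrite (_ : _ \o _ = fun x : 'rV[R]_n =>
    (\sum_i (y 0 i)%:E * (x 0 i)%:E)%E).
  by apply: integrable_sum => // i _; apply: integrableZl => //; exact: intK.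
apply/funext => x; rewrite /= /dot -sumEFin.
by apply: eq_bigr => i _; rewrite mulrC EFinM.
Qed.

Lemma scale_unit_ballE n (r : R) : 0 < r ->
  scale_about 0 r (@euclidean_unit_ball R n) = [set x | dot x x <= r ^+ 2].
Proof.
move=> r0; apply/seteqP; split=> x.
  move=> [z zB <-]; rewrite /= subr0 add0r dotxxZ.
  by rewrite ler_piMr ?sqr_ge0// -unit_ballE.
move=> /= xr; exists (r^-1 *: x); last first.
  by rewrite subr0 add0r scalerA divff ?gt_eqF// scale1r.
by rewrite unit_ballE dotxxZ exprVn mulrC ler_pdivrMr ?exprn_gt0// mul1r.
Qed.

Lemma measurable_scale_unit_ball n (r : R) : 0 < r ->
  measurable (scale_about 0 r (@euclidean_unit_ball R n)).
Proof.
move=> r0; rewrite scale_unit_ballE//; apply: measurable_le_cst.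
by apply: measurable_sum => i; apply: measurable_funM; exact: measurable_coord.
Qed.

End centroid.

(** * Choice of the dimension *)

Section large_dimension.
Context {R : realType}.

Lemma bernoulli_le (x : R) k : 0 <= x -> 1 + k%:R * x <= (1 + x) ^+ k.
Proof.
move=> x0; elim: k => [|k IHk]; first by rewrite mul0r addr0 expr0.
rewrite exprS -natr1; apply: (@le_trans _ _ ((1 + x) * (1 + k%:R * x))).
  by have : 0 <= k%:R :> R by []; nra.
by rewrite ler_wpM2l// addr_ge0.
Qed.

(** The second condition puts the ball of radius C sqrt N below height L/80; the third makes the low
    part of the body less than half of its volume. *)
Lemma large_dimension (C : R) : 0 < C -> exists N : nat, [/\ (9 <= N)%N,
  1 + 2 * (C * Num.sqrt N%:R) < N.+1%:R / 80 &
  2 * (N.+1%:R * (9 / 10) ^+ N) < (19 / 20 : R) ^+ N].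
Proof.
move=> C0; pose b := Num.bound (80 * (2 * C + 1)).
have bC : 80 * (2 * C + 1) < b%:R by apply: archi_boundP; lra.
(* A square N = k^2, so that sqrt N = k. *)
pose k := (1000 + b)%N; exists (k ^ 2)%N.
have k1000 : 1000 <= k%:R :> R by rewrite ler_nat leq_addr.
have kb : b%:R <= k%:R :> R by rewrite ler_nat leq_addl.
have kC : 80 * (2 * C + 1) < k%:R by exact: lt_le_trans kb.
move: kC kb k1000; set K : R := k%:R => kC kb k1000.
have KE : (k ^ 2)%:R = K ^+ 2 by rewrite natrX.
split.
- by rewrite (@leq_trans (1000 ^ 2))// leq_exp2r// leq_addr.
- rewrite -natr1 KE sqrtr_sqr ger0_norm; last by lra.
  by nra.
- have -> : (19 / 20 : R) = 19 / 18 * (9 / 10) by field.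
  rewrite [ltRHS]exprMn mulrA ltr_pM2r ?exprn_gt0 ?divr_gt0//.
  (* What remains is 2 (N + 1) < (19/18)^(k^2). By Bernoulli's inequality (19/18)^k >= 1 + k/18, and
     four of the k factors suffice: k >= 1000 gives (1 + k/18)^2 >= 3k, hence a fourth power of at
     least 9 k^2. *)
  apply: (@lt_le_trans _ _ ((1 + K / 18) ^+ 4)).
    rewrite -[(k ^ 2).+1%:R]natr1 KE (_ : 4%N = (2 * 2)%N)// exprM.
    have : 3 * K <= (1 + K / 18) ^+ 2 by nra.
    by move: ((1 + K / 18) ^+ 2) => z; nra.
  apply: (@le_trans _ _ ((1 + K / 18) ^+ k)).
    by rewrite ler_weXn2l//; lra.
  have step : 1 + K / 18 <= (19 / 18) ^+ k.
    rewrite (_ : 19 / 18 = 1 + 1 / 18 :> R); last by field.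
    by apply: le_trans (bernoulli_le _ _); lra.
  rewrite -mulnn exprM; apply: lerXn2r => //; rewrite nnegrE; first by lra.
  by apply: le_trans step; lra.
Qed.

End large_dimension.

(** * Failure of both assertions in a large dimension *)

Section counterexample.
Context {R : realType} (C : R) (N : nat) (u : 'I_N.+1 -> 'rV[R]_N).
Hypotheses (C0 : 0 < C) (N9 : (9 <= N)%N) (uP : simplex_normals u).
Hypothesis NC : 1 + 2 * (C * Num.sqrt N%:R) < N.+1%:R / 80.
Hypothesis Nexp : 2 * (N.+1%:R * (9 / 10) ^+ N) < (19 / 20 : R) ^+ N.

Local Notation L := (N.+1%:R : R).
Local Notation K := (lopsided u).
Local Notation ball := (@euclidean_unit_ball R N).
Local Notation r := (C * Num.sqrt N%:R).

Let r0 : 0 < r.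
Proof. by rewrite mulr_gt0// sqrtr_gt0 ltr0n (leq_trans _ N9). Qed.

Let mK : measurable K. Proof. exact: measurable_polyhedron. Qed.

Lemma vol_low_lt_half : (vol (lopsided_low u) < 2^-1%:E * vol K)%E.
Proof.
apply: (le_lt_trans (vol_lopsided_low N9 uP)).
apply: (@lt_le_trans _ _
  (2^-1%:E * (((19 / 20) ^+ N)%:E * vol (simplex u (fun=> 0%R))))%E); last first.
  by rewrite lee_wpmul2l//; exact: vol_lopsided_ge.
have := vol_simplex0_gt0 N9 uP.
rewrite -(fineK (vol_simplex0_fin N9 uP)) -!EFinM !lte_fin => v0.
rewrite mulrA ltr_pM2r//; move: Nexp.
by move: (_ ^+ N) (_ ^+ N) => a b; lra.
Qed.

(** On the ball of radius [r], <x, u_0>^2 <= 2 r^2, so y_0 <= 1 + 2 r < L/80. *)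
Lemma lopsided_cap_ball_low : K `&` scale_about 0 r ball `<=` lopsided_low u.
Proof.
move=> x [xK]; rewrite scale_unit_ballE// => /= xr; split => //=.
have := sqr_dot_le N9 uP x ord0.
set d := dot x _ => d2; move: NC xr d2 r0; set s := r.
move: (dot x x) => e NC' xr d2 s0.
have : - d <= 2 * s by rewrite leNgt; apply/negP; nra.
have : 0 < L by rewrite ltr0n.
by lra.
Qed.

Lemma lopsided_half_fails :
  ~ (2^-1%:E * vol K <= vol (K `&` scale_about 0 r ball))%E.
Proof.
apply/negP; rewrite -ltNge; apply: le_lt_trans vol_low_lt_half.
apply: le_measure lopsided_cap_ball_low; rewrite inE.
  by apply: measurableI => //; exact: measurable_scale_unit_ball.
exact: measurable_lopsided_low.
Qed.

Let vol_fin : vol K \is a fin_num.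
Proof.
rewrite ge0_fin_numE; last exact: measure_ge0.
apply: (@le_lt_trans _ _ (vol (simplex u (fun=> 0%R)))).
  apply: le_measure; rewrite ?inE//; first exact: measurable_simplex.
  by move=> x /lopsidedP[].
by rewrite -ge0_fin_numE; [exact: vol_simplex0_fin|exact: measure_ge0].
Qed.

(** Markov's inequality for the height y_0, which is nonnegative on the body and exceeds L/40 on
    more than half of its volume: the mean height, which is the height of the center of mass, is at
    least half of L/40. *)
Lemma lopsided_centroid_high :
  L / 80 <= 1 - dot (center_of_mass K) (u ord0).
Proof.
have Koo : (vol K < +oo)%E by rewrite -ge0_fin_numE//; exact: measure_ge0.
have [D _ SD] := simplex0_bounded N9 uP.
have KD : K `<=` cube N D by move=> x /lopsidedP[/SD].
have half := vol_low_lt_half.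
set k := fine (vol K).
have kE : vol K = k%:E by rewrite fineK.
have mlow := measurable_lopsided_low u.
have low_le : (vol (lopsided_low u) <= vol K)%E.
  by apply: le_measure; rewrite ?inE//; exact: subIsetl.
have low_fin : vol (lopsided_low u) \is a fin_num.
  rewrite ge0_fin_numE; last exact: measure_ge0.
  exact: le_lt_trans Koo.
have low0 : (0 <= vol (lopsided_low u))%E by exact: measure_ge0.
move: half low0; rewrite kE -(fineK low_fin) -EFinM lte_fin lee_fin.
set l := fine (vol (lopsided_low u)) => half low0.
have k0 : 0 < k by lra.
have intd := integrable_dot (u ord0) mK Koo KD.
pose f x := 1 - dot x (u ord0).
have int1 : vol.-integrable K (EFin \o (fun=> 1 : R)).
  apply: measurable_bounded_integrable => //.
  by exists 1; split=> [|M M1 x _]; rewrite ?normr1 ?num_real// ltW.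
have intf : vol.-integrable K (EFin \o f).
  rewrite (_ : _ \o _ = (fun x => 1%:E - (dot x (u ord0))%:E)%E).
    exact: integrableB.
  by apply/funext => x; rewrite /= EFinB.
have f0 x : K x -> 0 <= f x by move=> /lopsidedP[/(_ ord0)].
have mf : measurable_fun setT (EFin \o f).
  apply/measurable_EFinP; apply: measurable_funB => //.
  exact: measurable_dot.
have mD : measurable (K `\` lopsided_low u) by exact: measurableD.
have volD : vol (K `\` lopsided_low u) = (k - l)%:E.
  by rewrite measureD// setIidr ?kE ?EFinB ?fineK//; exact: subIsetl.
have lower : L / 40 * (k - l) <= \int[vol]_(x in K) f x.
  rewrite -lee_fin /Rintegral fineK; last exact: integrable_fin_num intf.
  apply: (@le_trans _ _ (\int[vol]_(x in K `\` lopsided_low u) (f x)%:E)%E).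
    rewrite EFinM -volD -integral_cst//.
    apply: ge0_le_integral => //=.
    - exact: measurable_funTS.
    - by move=> x [xK xlow]; rewrite lee_fin ltW// ltNge; apply/negP => xl; apply: xlow.
  by apply: ge0_subset_integral => //; exact: measurable_funTS.
move: lower; rewrite RintegralB// Rintegral_cst// mul1r -/k => lower.
rewrite (dot_center_of_mass _ mK Koo KD) -/k.
move: lower; set J := \int[vol]_(x in K) _ => lower.
have L0 : 0 < L by rewrite ltr0n.
have : L / 40 * (k / 2) <= k - J.
  by apply: le_trans lower; rewrite ler_wpM2l ?divr_ge0 ?(ltW L0)//; lra.
move=> H; rewrite -(ler_pM2l k0) mulrBr mulr1 mulVKf ?gt_eqF//.
by apply: le_trans H; rewrite le_eqVlt; apply/orP; left; apply/eqP; field.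
Qed.

(** A center of mass in the ball of radius [r] would have height at most 1 + 2 r, below L/80. *)
Lemma lopsided_centroid_fails :
  ~ scale_about 0 r ball (center_of_mass K).
Proof.
rewrite scale_unit_ballE// => /= xr; have := lopsided_centroid_high.
have := sqr_dot_le N9 uP (center_of_mass K) ord0.
set d := dot _ (u ord0) => d2; move: NC xr d2 r0; set s := r.
move: (dot _ _) => e NC' xr d2 s0.
have : - d <= 2 * s by rewrite leNgt; apply/negP; nra.
by lra.
Qed.

End counterexample.

(** For a given [C], a single body refutes both assertions, so it settles both implications. *)
Lemma lopsided_exists (R : realType) (C : R) : 0 < C ->
  exists (n : nat) (K : set 'rV[R]_n),
  let B := euclidean_unit_ball in
  [/\ convex_body K, john_ellipsoid K B, ellipsoid_centered_at 0 B,
      ~ (2^-1%:E * vol K <=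
         vol (K `&` scale_about 0 (C * Num.sqrt n%:R) B))%E &
      ~ scale_about 0 (C * Num.sqrt n%:R) B (center_of_mass K)].
Proof.
move=> C0; have [N [N9 NC Nexp]] := large_dimension C0.
have [u uP] := @simplex_normals_exist R N (leq_trans (isT : 0 < 9)%N N9).
exists N, (lopsided u); split.
- exact: convex_body_lopsided.
- exact: john_ellipsoid_lopsided.
- exact: ellipsoid_centered_at_unit_ball.
- exact: lopsided_half_fails.
- exact: lopsided_centroid_fails.
Qed.

Theorem corollary4p3 (R : realType) :
  (exists2 C : R, 0 < C &
     forall (n : nat) (K B : set 'rV[R]_n) (c : 'rV[R]_n),
       convex_body K -> john_ellipsoid K B -> ellipsoid_centered_at c B ->
       (2^-1%:E * vol K <=
          vol (K `&` scale_about c (C * Num.sqrt n%:R) B))%E)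
  <->
  (exists2 C : R, 0 < C &
     forall (n : nat) (K B : set 'rV[R]_n) (c : 'rV[R]_n),
       convex_body K -> john_ellipsoid K B -> ellipsoid_centered_at c B ->
       scale_about c (C * Num.sqrt n%:R) B (center_of_mass K)).
Proof.
split=> -[C C0 H]; have [n [K [cK jK eB nA nB]]] := lopsided_exists C0.
- by case: (nA (H _ _ _ _ cK jK eB)).
- by case: (nB (H _ _ _ _ cK jK eB)).
Qed.
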